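(* Let $x,y,z$ be integers with $0<x<z$ and $0<y<z$, with $\gcd(x,y,z)=1$, with $x$ odd and $y$ even, and such that the point $P=(x,y)$ has integer distance to each of the four vertices $(0,0)$, $(0,z)$, $(z,z)$, $(z,0)$ of the square of side length $z$; that is, each of $\sqrt{x^2+y^2}$, $\sqrt{x^2+(z-y)^2}$, $\sqrt{(z-x)^2+(z-y)^2}$, $\sqrt{(z-x)^2+y^2}$ is an integer. Then neither $x$ nor $z-x$ is an odd prime number.
   Context: The gcd condition means that no integer greater than $1$ divides all three of $x$, $y$, $z$ (pairwise coprimality is not assumed). *)

(* Defs.v *)
From Stdlib Require Export ZArith Znumtheory Reals.

Definition is_integer (r : R) : Prop := exists n : Z, r = IZR n.

Definition integer_distance (x y a b : Z) : Prop :=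
  is_integer (dist_euc (IZR x) (IZR y) (IZR a) (IZR b)).

Definition odd_prime (p : Z) : Prop := prime p /\ Z.Odd p.

(* Main.v *)
Require Import Defs.
From Stdlib Require Import ZArith Znumtheory Reals Lia.

(** If an odd prime [p] is a leg of a right triangle with integer sides, then
    [p^2] factors as (hypotenuse - other leg)(hypotenuse + other leg), and the
    only possible factorisation is [1 * p^2]: the other leg is [(p^2 - 1) / 2].
    When [x] is prime this applies both to [y] and to [z - y], so [z = 2y] and
    [P] lies on a midline of the square; when [z - x] is prime, reflecting the
    square in its vertical axis gives the same conclusion
    ([no_prime_leg_in_square]).

    Put [h = y = z / 2].  On the midline the four squared distances take only
    the two values [p^2 + h^2] and [(2h - p)^2 + h^2], and Sophie
    Germain's identity says that their product is [(p - h)^4 + 4 h^4].  Thus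
    [X^4 + 4 Y^4] is a square for [X = p - h], which is odd, and [Y = h], which is coprime to it.  This
    contradicts Fermat's descent ([no_quartic_plus_four_quartic]): from such a
    solution one obtains [X^2 = r^4 - s^4] with coprime [r] odd and [s] even,
    and from that in turn [r^2 = f^4 + 4 e^4] with [r] smaller than the
    original square root.  Both steps factor a difference of two squares into
    coprime factors with product a fourth power, or four times one
    ([coprime_product_fourth_power]). *)

Local Open Scope Z_scope.

(** * Squares, fourth powers and coprime factors *)

(** The root is [g = gcd a c]: with [a = g a'] and [c = g c'] one has
    [a' b = g c'^2], where [a'] is coprime to [c'] and [g] to [b], so that
    [a'] and [g] divide each other. *)
Lemma coprime_product_square (a b c : Z) :
  0 <= a -> rel_prime a b -> a * b = c ^ 2 -> exists g, 0 <= g /\ a = g ^ 2.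
Proof.
intros ha hab habc.
destruct (Z.eq_dec a 0) as [-> | ha0]; [exists 0; lia |].
assert (hg : 0 < Z.gcd a c).
{ pose proof (Z.gcd_nonneg a c). pose proof (Z.gcd_eq_0_l a c). lia. }
destruct (Z.gcd_divide_l a c) as [a' ea].
destruct (Z.gcd_divide_r a c) as [c' ec].
assert (hac' : rel_prime a' c').
{ apply bezout_rel_prime.
  destruct (Z.gcd_bezout a c (Z.gcd a c) eq_refl) as [u [v huv]].
  exists u v. apply (Z.mul_reg_r _ _ (Z.gcd a c)); [lia |].
  rewrite ea in huv at 1. rewrite ec in huv at 2. lia. }
set (g := Z.gcd a c) in *.
assert (hprod : a' * b = g * (c' * c')).
{ apply (Z.mul_reg_l _ _ g); [lia |]. rewrite ec, ea in habc. lia. }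
assert (hgb : rel_prime g b) by (apply (rel_prime_div a); [assumption | exists a'; lia]).
assert (ha'g : (a' | g)).
{ apply (Gauss a' (c' * c') g).
  - exists b. lia.
  - apply rel_prime_mult; assumption. }
assert (hga' : (g | a')).
{ apply (Gauss g b a'); [exists (c' * c'); lia | assumption]. }
exists g. split; [lia |].
assert (a' = g); [| subst a'; lia].
apply Z.divide_antisym_nonneg; try assumption; nia.
Qed.

Lemma coprime_product_fourth_power (a b c : Z) :
  0 <= a -> 0 <= b -> rel_prime a b -> a * b = c ^ 4 ->
  exists e f, 0 <= e /\ 0 <= f /\ a = e ^ 4 /\ b = f ^ 4.
Proof.
intros ha hb hab habc.
destruct (coprime_product_square a b (c ^ 2)) as [m [hm em]]; try lia; try assumption.
destruct (coprime_product_square b a (c ^ 2)) as [n [hn en]];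
  try lia; try (apply rel_prime_sym; assumption).
assert (hmn : rel_prime m n).
{ apply (rel_prime_div a); [| exists m; lia].
  apply rel_prime_sym, (rel_prime_div b); [| exists n; lia].
  apply rel_prime_sym; assumption. }
assert (emn : m * n = c ^ 2).
{ assert (0 <= m * n) by nia.
  assert ((m * n) * (m * n) = c ^ 2 * c ^ 2) by (subst; lia). nia. }
destruct (coprime_product_square m n c) as [e [he ee]]; try assumption.
destruct (coprime_product_square n m c) as [f [hf ef]];
  try lia; try (apply rel_prime_sym; assumption).
exists e, f. subst. repeat split; try assumption; ring.
Qed.

Lemma rel_prime_add_r (a b : Z) : rel_prime a b -> rel_prime a (b + a).
Proof.
intros hab. apply bezout_rel_prime.
destruct (rel_prime_bezout _ _ hab) as [u v huv].
exists (u - v) v. lia.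
Qed.

Lemma odd_square_mod_4 (a : Z) : Z.Odd a -> exists m, a ^ 2 = 4 * m + 1.
Proof. intros [k ->]. exists (k * k + k). ring. Qed.

Lemma odd_fourth_power_mod_4 (a : Z) : Z.Odd a -> exists m, a ^ 4 = 4 * m + 1.
Proof.
intros [k ->]. exists (4 * k ^ 4 + 8 * k ^ 3 + 6 * k ^ 2 + 2 * k). ring.
Qed.

Lemma even_fourth_power_mod_4 (a : Z) : Z.Even a -> exists m, a ^ 4 = 4 * m.
Proof. intros [k ->]. exists (4 * k ^ 4). ring. Qed.

Lemma fourth_power_pos (a : Z) : a <> 0 -> 0 < a ^ 4.
Proof.
intros ha. assert (0 < a * a) by nia.
replace (a ^ 4) with ((a * a) * (a * a)) by ring. nia.
Qed.

Lemma positive_factors (a b : Z) : 0 < a * b -> 0 <= a + b -> 0 < a /\ 0 < b.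
Proof. nia. Qed.

(** * Fermat's descent for X^4 + 4 Y^4 = Z^2 *)

(** Here [(Z - X^2) / 2] and [(Z + X^2) / 2] are coprime with product [Y^4].
    The parities of [r] and [s] come from [X^2 = 1] modulo 4. *)
Lemma square_quartic_plus_four_quartic (X Y Z : Z) :
  0 <= Z -> Z.Odd X -> Y <> 0 -> rel_prime X Y -> X ^ 4 + 4 * Y ^ 4 = Z ^ 2 ->
  exists r s, 0 < r < Z /\ 0 < s /\ Z.Odd r /\ Z.Even s /\ rel_prime s X /\
    X ^ 2 = r ^ 4 - s ^ 4.
Proof.
intros hZ [k hk] hY hXY heq.
destruct (Z.Even_or_Odd Z) as [[l hl] | [l hl]].
{ exfalso. subst. lia. }
assert (hu : exists u, Z - X ^ 2 = 2 * u).
{ exists (l - 2 * k * k - 2 * k). subst. lia. }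
destruct hu as [u hu].
assert (huv : u * (u + X ^ 2) = Y ^ 4).
{ replace Z with (X ^ 2 + 2 * u) in heq by lia. lia. }
assert (hX2 : 0 <= X ^ 2) by (apply Z.pow_even_nonneg; exists 1; reflexivity).
assert (hu0 : 0 < u).
{ apply (positive_factors u (u + X ^ 2)); [| lia].
  rewrite huv. apply fourth_power_pos. assumption. }
assert (huX : rel_prime u X).
{ apply (rel_prime_div (Y ^ 4)).
  - apply rel_prime_sym. replace (Y ^ 4) with (Y * (Y * (Y * Y))) by ring.
    repeat apply rel_prime_mult; assumption.
  - exists (u + X ^ 2). lia. }
destruct (coprime_product_fourth_power u (u + X ^ 2) Y)
  as [s [r [hs [hr [es er]]]]]; try lia.
{ rewrite Z.add_comm. apply rel_prime_add_r.
  replace (X ^ 2) with (X * X) by ring. apply rel_prime_mult; assumption. }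
assert (hs0 : 0 < s) by (destruct (Z.eq_dec s 0); [subst s; simpl in *; lia | lia]).
assert (hr0 : 0 < r) by (destruct (Z.eq_dec r 0); [subst r; simpl in *; lia | lia]).
assert (hX : X ^ 2 = r ^ 4 - s ^ 4) by lia.
assert (hrs : Z.Odd r /\ Z.Even s).
{ destruct (odd_square_mod_4 X) as [m hm]; [exists k; assumption |].
  destruct (Z.Even_or_Odd r) as [hr' | hr'];
  destruct (Z.Even_or_Odd s) as [hs' | hs'];
  try (split; assumption); exfalso;
  (apply even_fourth_power_mod_4 in hr' as [r' hr']
    || apply odd_fourth_power_mod_4 in hr' as [r' hr']);
  (apply even_fourth_power_mod_4 in hs' as [s' hs']
    || apply odd_fourth_power_mod_4 in hs' as [s' hs']);
  clear - hX hm hr' hs'; lia. }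
exists r, s. split; [split |]; [assumption | |].
- assert (r <= r ^ 4) by (rewrite <- (Z.pow_1_r r) at 1; apply Z.pow_le_mono_r; lia).
  lia.
- destruct hrs as [hro hse]. do 3 (split; [assumption |]). split; [| assumption].
  apply (rel_prime_div u); [assumption | exists (s ^ 3); rewrite es; ring].
Qed.

(** As [b] is odd, the factor 4 sits in [a], and [a / 4] and [b] are coprime
    with product [t^4]. *)
Lemma coprime_product_four_fourth_power (a b t : Z) :
  0 <= a -> 0 <= b -> Z.Odd b -> rel_prime a b -> a * b = 4 * t ^ 4 ->
  exists e f, a = 4 * e ^ 4 /\ b = f ^ 4.
Proof.
intros ha hb [k hk] hab habt.
assert (h4 : (4 | a)).
{ apply (Gauss 4 b a).
  - exists (t ^ 4). lia.
  - change 4 with (2 * 2). apply rel_prime_sym, rel_prime_mult;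
      apply bezout_rel_prime; exists 1 (- k); lia. }
destruct h4 as [a' ea].
destruct (coprime_product_fourth_power a' b t) as [e [f [_ [_ [ee ef]]]]];
  try lia.
{ apply (rel_prime_div a); [assumption | exists 4; lia]. }
exists e, f. lia.
Qed.

(** The factors of [s^4 = (r^2 - X)(r^2 + X)], halved, are coprime, have
    sum [r^2] and product [4 (s / 2)^4].  Exactly one of them is odd, since
    [r] is; changing the sign of [X] exchanges them, so either may be the
    odd one. *)
Lemma square_quartic_minus_quartic (X r s : Z) :
  0 < s -> Z.Odd X -> Z.Odd r -> Z.Even s -> rel_prime s X ->
  X ^ 2 = r ^ 4 - s ^ 4 ->
  exists f e, Z.Odd f /\ e <> 0 /\ rel_prime f e /\ f ^ 4 + 4 * e ^ 4 = r ^ 2.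
Proof.
intros hs [k hk] [l hl] [t ht] hsX hX.
assert (ha : exists a, r ^ 2 - X = 2 * a).
{ exists (2 * l * l + 2 * l - k). subst. lia. }
destruct ha as [a ha].
set (b := a + X).
assert (hab : a * b = 4 * t ^ 4).
{ assert (hX' : X ^ 2 = (X + 2 * a) ^ 2 - s ^ 4).
  { replace (X + 2 * a) with (r ^ 2) by lia. lia. }
  unfold b. rewrite ht in hX'. lia. }
assert (hsum : a + b = r ^ 2) by (unfold b; lia).
assert (hpos : 0 < a /\ 0 < b).
{ apply positive_factors.
  - rewrite hab. pose proof (fourth_power_pos t). lia.
  - rewrite hsum. apply Z.pow_even_nonneg. exists 1. reflexivity. }
destruct hpos as [ha0 hb0].
assert (haX : rel_prime a X).
{ apply (rel_prime_div (s ^ 4)).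
  - apply rel_prime_sym. replace (s ^ 4) with (s * (s * (s * s))) by ring.
    repeat apply rel_prime_mult; apply rel_prime_sym; assumption.
  - exists (4 * b). rewrite ht. lia. }
assert (hcop : rel_prime a b).
{ unfold b. rewrite Z.add_comm. apply rel_prime_add_r. assumption. }
assert (main : forall u v, 0 < u -> 0 < v -> Z.Odd v -> rel_prime u v ->
  u * v = 4 * t ^ 4 -> u + v = r ^ 2 ->
  exists f e, Z.Odd f /\ e <> 0 /\ rel_prime f e /\ f ^ 4 + 4 * e ^ 4 = r ^ 2).
{ intros u v hu hv [j hj] huv hp hsm.
  destruct (coprime_product_four_fourth_power u v t) as [e [f [ee ef]]];
    try lia; try assumption.
  { exists j; assumption. }
  exists f, e. split; [| split; [| split; [| lia]]].
  - destruct (Z.Even_or_Odd f) as [[f' hf] | hf]; [| assumption].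
    exfalso. rewrite hf in ef. lia.
  - intros ->. simpl in ee. lia.
  - apply (rel_prime_div v); [| exists (f ^ 3); rewrite ef; ring].
    apply rel_prime_sym, (rel_prime_div u); [assumption |].
    exists (4 * e ^ 3). rewrite ee. ring. }
destruct (Z.Even_or_Odd b) as [[b' hb] | hb].
- apply (main b a); try lia.
  + destruct (Z.Even_or_Odd a) as [[a' ha'] | ha']; [| assumption].
    exfalso. rewrite hl, ha', hb in hsum. lia.
  + apply rel_prime_sym. assumption.
- apply (main a b); assumption.
Qed.

(** The root [r] of the second solution is a fourth root of one of the two
    summands of [Z = r^4 + s^4], hence smaller than [Z]. *)
Theorem no_quartic_plus_four_quartic (X Y Z : Z) :
  0 <= Z -> Z.Odd X -> Y <> 0 -> rel_prime X Y -> X ^ 4 + 4 * Y ^ 4 <> Z ^ 2.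
Proof.
intros hZ. revert X Y. pattern Z. apply Zlt_0_ind; [| assumption].
clear Z hZ. intros Z IH hZ X Y hX hY hXY heq.
destruct (square_quartic_plus_four_quartic X Y Z)
  as (r & s & hr & hs & hro & hse & hsX & hXrs); try assumption.
destruct (square_quartic_minus_quartic X r s)
  as (f & e & hf & he & hfe & hr2); try assumption.
apply (IH r ltac:(lia) f e); assumption.
Qed.

(** * Prime legs *)

Lemma prime_leg (p y a : Z) :
  prime p -> 0 < y -> 0 <= a -> p ^ 2 + y ^ 2 = a ^ 2 -> p ^ 2 = 2 * y + 1.
Proof.
intros hp hy ha heq.
assert (hp2 : 2 <= p) by (apply prime_ge_2; assumption).
assert (hf : (a - y) * (a + y) = p * p) by lia.
assert (hay : y < a) by nia.
destruct (prime_mult p hp (a - y) (a + y)) as [[k hk] | [k hk]];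
  [exists p; lia | |].
- assert (hk' : k * (a + y) = p).
  { rewrite hk in hf. apply (Z.mul_reg_l _ _ p); [lia |]. lia. }
  assert (hd : (a + y | p)) by (exists k; lia).
  (* a + y = p would force a - y = p, hence y = 0 *)
  destruct (prime_divisors p hp _ hd) as [h | [h | [h | h]]]; lia.
- assert (hk' : k * (a - y) = p).
  { rewrite hk in hf. apply (Z.mul_reg_l _ _ p); [lia |]. lia. }
  assert (hd : (a - y | p)) by (exists k; lia).
  destruct (prime_divisors p hp _ hd) as [h | [h | [h | h]]]; lia.
Qed.

(** The three distances used are those to the two vertices on the side at
    distance [p] and to one further vertex; this is the common core of the
    cases [p = x] and [p = z - x]. *)
Lemma no_prime_leg_in_square (p y z a b d : Z) :
  odd_prime p -> Z.Even y -> 0 < y < z -> 0 <= a -> 0 <= b -> 0 <= d ->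
  p ^ 2 + y ^ 2 = a ^ 2 -> p ^ 2 + (z - y) ^ 2 = b ^ 2 ->
  (z - p) ^ 2 + y ^ 2 <> d ^ 2.
Proof.
intros [hp hpo] hye hy ha hb hd e1 e2 e3.
assert (h1 : p ^ 2 = 2 * y + 1) by (apply (prime_leg p y a); assumption || lia).
assert (h2 : p ^ 2 = 2 * (z - y) + 1)
  by (apply (prime_leg p (z - y) b); assumption || lia).
assert (hz : z = 2 * y) by (clear - h1 h2; lia). subst z.
apply (no_quartic_plus_four_quartic (p - y) y (a * d)).
- apply Z.mul_nonneg_nonneg; assumption.
- destruct hpo as [i hi], hye as [j hj]. exists (i - j). lia.
- lia.
- (* p^2 - 2 y = 1, rewritten in terms of p - y and y *)
  apply bezout_rel_prime. exists p (p - 2). lia.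
- rewrite Z.pow_mul_l, <- e1, <- e3. ring.
Qed.

Lemma integer_distance_square (x y a b : Z) :
  integer_distance x y a b ->
  exists n, 0 <= n /\ (x - a) ^ 2 + (y - b) ^ 2 = n ^ 2.
Proof.
intros [n hn]. unfold dist_euc in hn.
exists n. split.
- apply le_IZR. rewrite <- hn. apply sqrt_pos.
- apply eq_IZR. rewrite Z.pow_2_r, (Z.pow_2_r n), (Z.pow_2_r (y - b)).
  rewrite plus_IZR, !mult_IZR, <- hn, sqrt_sqrt, !minus_IZR.
  + unfold Rsqr. reflexivity.
  + apply Rplus_le_le_0_compat; apply Rle_0_sqr.
Qed.

Theorem theorem3 (x y z : Z)
  (hx : (0 < x < z)%Z) (hy : (0 < y < z)%Z)
  (hgcd : Z.gcd x (Z.gcd y z) = 1%Z)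
  (hxodd : Z.Odd x) (hyeven : Z.Even y)
  (h00 : integer_distance x y 0 0)
  (h0z : integer_distance x y 0 z)
  (hzz : integer_distance x y z z)
  (hz0 : integer_distance x y z 0) :
  ~ odd_prime x /\ ~ odd_prime (z - x).
Proof.
destruct (integer_distance_square _ _ _ _ h00) as [a [ha ea]].
destruct (integer_distance_square _ _ _ _ h0z) as [b [hb eb]].
destruct (integer_distance_square _ _ _ _ hzz) as [c [hc ec]].
destruct (integer_distance_square _ _ _ _ hz0) as [d [hd ed]].
split; intros hp.
- apply (no_prime_leg_in_square x y z a b d); assumption || lia.
- apply (no_prime_leg_in_square (z - x) y z d c a); assumption || lia.
Qed.
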